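(* Let $\phi\in\Phi$ and let $P\in\mathcal{D}$ be a finite log-concave measure, i.e. a finite measure whose density function $p\in\mathcal{F}^+$ belongs to $\mathcal{D}$ and is a log-concave function. Then $$\widetilde{\Omega}_\phi^{orlicz}(P)\le\widetilde{G}_\phi^{orlicz}(P)\le\widetilde{G}_\phi^{orlicz}(\gamma_n\circ c_1),$$ where $c_1>0$ is the constant determined by $$c_1=\left(\frac{\mu(p^\circ)}{\mu(\gamma_n)}\right)^{1/n}.$$
   Context: The underlying space is $\mathbb{R}^n$ with Lebesgue measure; for a nonnegative measurable function $p$ write $\mu(p)=\int_{\mathbb{R}^n}p(x)\,dx$. $\mathcal{F}^+$ is the set of positive real-valued measurable functions on $\mathbb{R}^n$, and $\mathcal{M}^+$ is the set of finite measures on $\mathbb{R}^n$ having a density (with respect to Lebesgue measure) in $\mathcal{F}^+$. Let $\gamma_n(x)=e^{-\|x\|_2^2/2}$ with $\|\cdot\|_2$ the Euclidean norm, and for $c>0$ let $(\gamma_n\circ c)(x)=\gamma_n(cx)$; when a functional of measures is applied to $\gamma_n\circ c$, this means the measure with density $\gamma_n\circ c$. For $p\in\mathcal{F}^+$, its polar dual function is $p^\circ(y)=\inf_{x\in\mathbb{R}^n}\frac{e^{-\langle x,y\rangle}}{p(x)}$. Let $\mathcal{D}=\{p\in\mathcal{F}^+:\mu(p)\mu(p^\circ)\le[\mu(\gamma_n)]^2\}$, where $\mu(\gamma_n)^2=(2\pi)^n$, and let $\mathcal{L}_c$ be the set of log-concave functions on $\mathbb{R}^n$ (functions of the form $e^{-\psi}$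 with $\psi$ convex). Writing $Q\in\mathcal{D}$ (resp. $Q\in\mathcal{D}\cap\mathcal{L}_c$) for a finite measure $Q$ means that its density $q$ belongs to $\mathcal{D}$ (resp. $\mathcal{D}\cap\mathcal{L}_c$). $\Phi$ is the set of functions $\phi:(0,\infty)\to(0,\infty)$ that are decreasing and strictly convex. For measures $P,Q$ with densities $p,q$ and a constant $a\ge 0$, $D_\phi(aQ,P)=\int_{\mathbb{R}^n}\phi\left(\frac{a\,q(x)}{p(x)}\right)p(x)\,dx$, with the convention $\phi(0)=\lim_{t\to0^+}\phi(t)\in[0,\infty]$. For $\phi\in\Phi$ and $P\in\mathcal{M}^+$ the dual functional Orlicz affine surface area is $$\widetilde{\Omega}_\phi^{orlicz}(P)=\inf_{Q\in\mathcal{D}}D_\phi\left(\frac{\mu(q^\circ)}{\mu(\gamma_n)}Q,P\right),$$ and the dual functional Orlicz geominimal surface area $\widetilde{G}_\phi^{orlicz}(P)$ is defined in the same way with $\mathcal{D}$ replaced by $\mathcal{D}\cap\mathcal{L}_c$. *)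

(* Defs.v *)
From HB Require Import structures.
From mathcomp Require Import all_boot all_order all_algebra.
From mathcomp Require Import all_classical all_reals all_analysis.
Set Implicit Arguments.
Unset Strict Implicit.
Unset Printing Implicit Defensive.
Import Order.TTheory GRing.Theory Num.Theory.
Import numFieldNormedType.Exports.
Local Open Scope classical_set_scope.
Local Open Scope ring_scope.

(* R^n is 'rV[R]_n with the sigma-algebra generated by the n coordinate maps,
   i.e. its Borel sigma-algebra. *)
Definition coord_rV (R : realType) (n : nat) : 'I_n -> 'rV[R]_n -> R :=
  fun i v => v ord0 i.

Section measurable_rV.
Context (R : realType) (n : nat).

Let rV_set0 : g_sigma_preimage (@coord_rV R n) set0.
Proof. exact: sigma_algebra0. Qed.

Let rV_setC A : g_sigma_preimage (@coord_rV R n) A ->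
  g_sigma_preimage (@coord_rV R n) (~` A).
Proof. exact: sigma_algebraC. Qed.

Let rV_bigcup (F : _^nat) :
  (forall i, g_sigma_preimage (@coord_rV R n) (F i)) ->
  g_sigma_preimage (@coord_rV R n) (\bigcup_i (F i)).
Proof. exact: sigma_algebra_bigcup. Qed.

HB.instance Definition _ := @isMeasurable.Build default_measure_display
  'rV[R]_n (g_sigma_preimage (@coord_rV R n)) rV_set0 rV_setC rV_bigcup.

End measurable_rV.

Lemma measurable_coord_rV (R : realType) (n : nat) (i : 'I_n) :
  measurable_fun [set: 'rV[R]_n] (@coord_rV R n i).
Proof.
move=> _ Y mY; rewrite setTI; apply: sub_sigma_algebra => /=.
rewrite -bigcup_seq/=; exists i => /=; first by rewrite mem_index_enum.
by exists Y => //; rewrite setTI.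
Qed.

Lemma measurable_fun_rVP d (T : measurableType d) (R : realType) (n : nat)
    (f : T -> 'rV[R]_n) :
  measurable_fun [set: T] f <->
  forall i, measurable_fun [set: T] (@coord_rV R n i \o f).
Proof.
split=> [mf i|mf].
  by apply: measurableT_comp => //; exact: measurable_coord_rV.
rewrite /measurable_fun => _ A; rewrite setTI => mA.
pose G : set (set 'rV[R]_n) := [set B | measurable (f @^-1` B)].
suff : g_sigma_preimage (@coord_rV R n) `<=` G by exact.
apply: smallest_sub.
  split => //=.
  - by rewrite /G/= preimage_set0; exact: measurable0.
  - by move=> B mB; rewrite /G/= setTD preimage_setC; exact: measurableC.
  - by move=> F mF; rewrite /G/= preimage_bigcup; exact: bigcupT_measurable.
rewrite -bigcup_seq => B [/= i _ [C mC <-]]; rewrite /G/= setTI.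
by have := mf i measurableT C mC; rewrite setTI.
Qed.

Definition cons_rV (R : realType) (n : nat)
    (xv : measurableTypeR R * 'rV[R]_n) : 'rV[R]_n.+1 :=
  \row_(i < n.+1) if unlift ord0 i is Some j then xv.2 ord0 j else xv.1.

Lemma measurable_cons_rV (R : realType) (n : nat) :
  measurable_fun setT (@cons_rV R n).
Proof.
apply/measurable_fun_rVP => i.
have [j ->|->] := unliftP ord0 i.
  rewrite (_ : _ \o _ = @coord_rV R n j \o snd); last first.
    by apply/funext => xv; rewrite /coord_rV/cons_rV/= mxE liftK.
  by apply: measurableT_comp => //; exact: measurable_coord_rV.
rewrite (_ : _ \o _ = fst)//.
by apply/funext => xv; rewrite /coord_rV/cons_rV/= mxE unlift_none.
Qed.

Definition uncons_rV (R : realType) (n : nat)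
    (v : 'rV[R]_n.+1) : measurableTypeR R * 'rV[R]_n :=
  (v ord0 ord0, \row_(j < n) v ord0 (lift ord0 j)).

Lemma measurable_uncons_rV (R : realType) (n : nat) :
  measurable_fun setT (@uncons_rV R n).
Proof.
apply: measurable_fun_pair; first exact: measurable_coord_rV.
apply/measurable_fun_rVP => i.
rewrite (_ : _ \o _ = @coord_rV R n.+1 (lift ord0 i)).
  exact: measurable_coord_rV.
by apply/funext => v; rewrite /coord_rV/= mxE.
Qed.

Lemma cons_rVK (R : realType) (n : nat) :
  cancel (@cons_rV R n) (@uncons_rV R n).
Proof.
case=> x v; congr pair; first by rewrite /= mxE unlift_none.
by apply/rowP => j; rewrite !mxE liftK.
Qed.

Section lebesgue_rV_rec.
Context (R : realType) (n : nat).
Variable m : {sigma_finite_measure set 'rV[R]_n -> \bar R}.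

Definition lebesgue_rVS : set 'rV[R]_n.+1 -> \bar R :=
  pushforward (@lebesgue_measure R \x m)%E (@cons_rV R n).

Let lebesgue_rVS0 : lebesgue_rVS set0 = 0%E.
Proof. by rewrite /lebesgue_rVS /pushforward preimage_set0 measure0. Qed.

Let lebesgue_rVS_ge0 A : (0 <= lebesgue_rVS A)%E.
Proof. by rewrite /lebesgue_rVS /pushforward; apply: measure_ge0. Qed.

Let lebesgue_rVS_sigma_additive : semi_sigma_additive lebesgue_rVS.
Proof.
move=> F mF tF mUF; rewrite /lebesgue_rVS /pushforward preimage_bigcup.
have mcF k : measurable (@cons_rV R n @^-1` F k).
  by rewrite -[X in measurable X]setTI; exact: measurable_cons_rV.
apply: measure_semi_sigma_additive => //; last exact: bigcupT_measurable.
apply/trivIsetP => /= i j _ _ ij; rewrite -preimage_setI.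
by move/trivIsetP : tF => /(_ _ _ _ _ ij) ->//; rewrite preimage_set0.
Qed.

HB.instance Definition _ := isMeasure.Build _ _ _ lebesgue_rVS
  lebesgue_rVS0 lebesgue_rVS_ge0 lebesgue_rVS_sigma_additive.

Let lebesgue_rVS_sigma_finite : sigma_finite setT lebesgue_rVS.
Proof.
have /sigma_finiteP[F [TF ndF Foo]] := sigma_finiteT (@lebesgue_measure R).
have /sigma_finiteP[G [TG ndG Goo]] := sigma_finiteT m.
exists (fun k => @uncons_rV R n @^-1` (F k `*` G k)).
  rewrite -preimage_bigcup -[LHS](preimage_setT (@uncons_rV R n)).
  congr (_ @^-1` _); rewrite -setXTT TF TG predeqE => -[x y]; split.
    move=> [/= [k _ Fkx] [l _ Gly]]; exists (maxn k l) => //; split.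
    - by move: x Fkx; exact/subsetPset/ndF/leq_maxl.
    - by move: y Gly; exact/subsetPset/ndG/leq_maxr.
  by move=> [k _ []/= ? ?]; split; exists k.
move=> k; have [mF Fk] := Foo k; have [mG Gk] := Goo k; split.
  by rewrite -[X in measurable X]setTI; apply: measurable_uncons_rV => //;
    exact: measurableX.
rewrite /lebesgue_rVS /pushforward (_ : _ @^-1` _ = F k `*` G k).
  by rewrite product_measure1E// lte_mul_pinfty// ge0_fin_numE.
by apply/seteqP; split => xv; rewrite /preimage/mkset cons_rVK.
Qed.

HB.instance Definition _ := Measure_isSigmaFinite.Build _ _ _ lebesgue_rVS
  lebesgue_rVS_sigma_finite.

End lebesgue_rV_rec.

(* R^0 carries the Dirac mass at its only point; the measure on R^(n+1) is the
   image of the product of the measures on R and R^n by (x, v) |-> x :: v. *)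
Fixpoint lebesgue_rV (R : realType) (n : nat) :
    {sigma_finite_measure set 'rV[R]_n -> \bar R} :=
  if n is k.+1 then lebesgue_rVS (@lebesgue_rV R k)
  else @dirac _ 'rV[R]_0 0 R.

Lemma lebesgue_rV_box (R : realType) (n : nat) (A : 'I_n -> set R) :
  (forall i, measurable (A i)) ->
  lebesgue_rV R n [set v | forall i, A i (v ord0 i)] =
  (\prod_(i < n) lebesgue_measure (A i))%E.
Proof.
elim: n A => [|n IH] A mA /=.
  by rewrite big_ord0 diracE mem_set//= => -[].
rewrite big_ord_recl -IH// -product_measure1E//.
- rewrite /lebesgue_rVS /pushforward; congr (_ _).
  apply/seteqP; split => -[x v] /=.
    move=> Av; split.
      by have := Av ord0; rewrite mxE unlift_none.
    by move=> i; have := Av (lift ord0 i); rewrite mxE liftK.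
  move=> [Ax Av] i; rewrite mxE.
  by have [j ->|->] := unliftP ord0 i; [exact: Av|exact: Ax].
- exact: mA.
- rewrite [X in measurable X](_ : _ =
      \big[setI/setT]_(i < n) (@coord_rV R n i @^-1` A (lift ord0 i))).
    apply: bigsetI_measurable => i _.
    by rewrite -[X in measurable X]setTI; exact: measurable_coord_rV.
  apply/seteqP; split => v; rewrite -bigcap_seq/=.
    by move=> Av i _; exact: Av.
  by move=> Av i; apply: (Av i); rewrite /= mem_index_enum.
Qed.

Section dual_orlicz.
Context (R : realType) (n : nat).
Local Notation Rn := 'rV[R]_n.
Implicit Types (p q : Rn -> R) (phi : R -> R).

Definition mu p : \bar R := (\int[lebesgue_rV R n]_x (p x)%:E)%E.

Definition dotp (x y : Rn) : R := \sum_(i < n) x ord0 i * y ord0 i.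

(* The library norm on 'rV[R]_n is the sup norm. *)
Definition norm2 (x : Rn) : R := Num.sqrt (\sum_(i < n) x ord0 i ^+ 2).

Definition gauss (x : Rn) : R := expR (- (norm2 x ^+ 2 / 2)).

Definition gauss_comp (c : R) (x : Rn) : R := gauss (c *: x).

Definition Fplus : set (Rn -> R) :=
  [set p : Rn -> R | measurable_fun setT p /\ forall x, 0 < p x].

(* M^+ is the set of finite measures P such that has_density P p for some p. *)
Definition has_density (P : {finite_measure set Rn -> \bar R}) p : Prop :=
  Fplus p /\
  forall A, measurable A -> P A = (\int[lebesgue_rV R n]_(x in A) (p x)%:E)%E.

Definition polar p (y : Rn) : R := inf [set expR (- dotp x y) / p x | x in setT].

Definition classD : set (Rn -> R) :=
  [set p : Rn -> R | Fplus p /\ (mu p * mu (polar p) <= mu gauss ^+ 2)%E].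

(* Only positive functions are ever tested for membership, so psi is
   real-valued. *)
Definition log_concave : set (Rn -> R) :=
  [set p : Rn -> R | exists2 psi : Rn -> R, convex_function setT psi &
    forall x, p x = expR (- psi x)].

(* phi is constrained, and used, on ]0, +oo[ only. *)
Definition class_Phi : set (R -> R) :=
  [set phi : R -> R | [/\ forall t, 0 < t -> 0 < phi t,
    forall s t, 0 < s -> s <= t -> phi t <= phi s &
    forall s t l, 0 < s -> 0 < t -> s != t -> 0 < l -> l < 1 ->
      phi (l * s + (1 - l) * t) < l * phi s + (1 - l) * phi t]].

Definition phi_ext phi (t : R) : \bar R :=
  if t == 0 then lim ((phi s)%:E @[s --> 0^'+]) else (phi t)%:E.

(* D_phi(aQ, P), for measures Q, P with densities q, p. *)
Definition orlicz_div phi (a : R) q p : \bar R :=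
  (\int[lebesgue_rV R n]_x (phi_ext phi (a * q x / p x) * (p x)%:E))%E.

(* inf of D_phi((mu(q^o)/mu(gauss)) Q, P) over the finite measures Q whose
   density q is in C; the measure P is given through its density p.  For such q
   in classD, mu (polar q) is finite since mu q is positive. *)
Definition orlicz_inf (C : set (Rn -> R)) phi p : \bar R :=
  ereal_inf [set orlicz_div phi (fine (mu (polar q)) / fine (mu gauss)) q p
    | q in [set q | C q /\ exists Q : {finite_measure set Rn -> \bar R},
                              has_density Q q]].

Definition dual_orlicz_affine phi p : \bar R := orlicz_inf classD phi p.

Definition dual_orlicz_geominimal phi p : \bar R :=
  orlicz_inf (classD `&` log_concave) phi p.

End dual_orlicz.

(* Main.v *)
Require Import Defs.
From HB Require Import structures.
From mathcomp Require Import all_boot all_order all_algebra.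
From mathcomp Require Import all_classical all_reals all_analysis.
From mathcomp Require Import measurable_realfun ring lra.
Set Implicit Arguments.
Unset Strict Implicit.
Unset Printing Implicit Defensive.
Import Order.TTheory GRing.Theory Num.Theory.
Import numFieldNormedType.Exports.
Local Open Scope classical_set_scope.
Local Open Scope ring_scope.

(** Write N for the total mass of gauss and a(q) = mu(q^o) / N. Every q in
   D satisfies a(q) mu(q) <= N ([classD_normalized]), and c1 is chosen so that
   c1 ^ n = a(p).

   The affine infimum runs over a larger class than the geominimal one, which
   gives the first inequality. For the second one, both sides are compared with
   phi(c1 ^ n) N / c1 ^ n.

   - On the left, p itself is a competitor. The ratio a(p) p / p is constant,
     hence its divergence is phi(a(p)) mu(p) ([orlicz_div_self]), and
     mu(p) <= N / a(p) since p is in D.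

   - On the right, let w be the density gauss_comp c1, of mass N / c1 ^ n, and q
     any competitor. Jensen's inequality bounds the divergence from below by
     mu(w) phi(a(q) mu(q) / mu(w)). As a(q) mu(q) <= N and phi is decreasing,
     this is at least mu(w) phi(N / mu(w)) = (N / c1 ^ n) phi(c1 ^ n).

   Jensen's inequality is used in the additive form of [jensen_orlicz_div]: with
   the slope -k of a supporting line of phi at t0,
   (phi(t0) + k t0) mu(w) <= D_phi(a q, w) + k a mu(q). All the terms are
   nonnegative, so it also holds when some of them are infinite. This settles
   the degenerate case a(p) = 0, in which c1 = 0: then gauss_comp c1 is the
   constant 1, whose mass is infinite, while mu(q) is finite, so that every
   divergence on the right-hand side is infinite ([geominimal_infinite]). *)

(** * Integration on R^n *)

Section integral.
Local Open Scope ereal_scope.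

(** For nonnegative functions the integral is a supremum over the simple
   functions below the integrand, so monotonicity needs no measurability. It is
   what bounds the divergence from below, as nothing is known about the
   measurability of phi. *)
Lemma le_ge0_integral d (T : measurableType d) (R : realType)
    (m : {measure set T -> \bar R}) (f g : T -> \bar R) :
  (forall x, 0 <= f x) -> (forall x, f x <= g x) ->
  \int[m]_x f x <= \int[m]_x g x.
Proof.
move=> f0 fg; rewrite !ge0_integralTE//; last first.
  by move=> x; exact: le_trans (fg x).
apply: ereal_sup_le => _ [h hf <-]; exists h => // x.
exact: le_trans (hf x) (fg x).
Qed.

(** Tonelli's theorem, one coordinate at a time along the recursive construction
   of the Lebesgue measure of R^n. *)
Lemma integral_prod_coord (R : realType) (n : nat) (g : R -> R) (K : R) :
  measurable_fun [set: R] g -> (forall t, (0 <= g t)%R) ->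
  \int[lebesgue_measure]_t (g t)%:E = K%:E ->
  \int[lebesgue_rV R n]_v (\prod_(i < n) g (v ord0 i))%:E = (K ^+ n)%:E.
Proof.
move=> mg g0 gK.
have mprod m : measurable_fun [set: 'rV[R]_m]
    (EFin \o (fun v : 'rV[R]_m => \prod_(i < m) g (v ord0 i))%R).
  apply/measurable_EFinP; apply: measurable_prod => i _.
  by apply: measurableT_comp => //; exact: measurable_coord_rV.
have prod0 m (v : 'rV[R]_m) : 0 <= (\prod_(i < m) g (v ord0 i))%:E.
  by rewrite lee_fin; apply: prodr_ge0.
have K0 : 0 <= K%:E by rewrite -gK; apply: integral_ge0 => t _; rewrite lee_fin.
elim: n => [|n IH].
  rewrite integral_dirac ?diracT//; last exact: mprod.
  by rewrite big_ord0 mul1e.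
have -> : \int[lebesgue_rV R n.+1]_v (\prod_(i < n.+1) g (v ord0 i))%:E
  = \int[lebesgue_measure \x lebesgue_rV R n]_z
      ((g z.1)%:E * (\prod_(i < n) g (z.2 ord0 i))%:E).
  rewrite [LHS](@ge0_integral_pushforward _ _ _ _ R _ (@measurable_cons_rV R n))//;
    last exact: mprod.
  rewrite preimage_setT; apply: eq_integral => -[t v] _ /=.
  rewrite big_ord_recl -EFinM mxE unlift_none; congr (_ * _)%:E.
  by apply: eq_bigr => i _; rewrite mxE liftK.
rewrite fubini_tonelli1//; last 2 first.
- apply: emeasurable_funM.
    by apply/measurable_EFinP; exact: measurableT_comp.
  exact: (measurableT_comp (mprod n)).
- by move=> z; rewrite mule_ge0// lee_fin.
rewrite /fubini_F/=.
transitivity (\int[lebesgue_measure]_t ((g t)%:E * (K ^+ n)%:E)).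
  apply: eq_integral => t _; rewrite -IH ge0_integralZl_EFin//.
    by move=> v _; exact: prod0.
  exact: mprod.
rewrite ge0_integralZr//; last first.
  - by rewrite lee_fin exprn_ge0// -lee_fin.
  - by move=> t _; rewrite lee_fin.
  - exact/measurable_EFinP.
by rewrite gK -EFinM exprS.
Qed.

End integral.

(** * Gaussian densities *)

Lemma gauss_compE (R : realType) n (c : R) (x : 'rV[R]_n) :
  gauss_comp c x = \prod_(i < n) expR (- ((c * x ord0 i) ^+ 2 / 2)).
Proof.
rewrite /gauss_comp /gauss /norm2 sqr_sqrtr ?sumr_ge0//; last first.
  by move=> i _; exact: sqr_ge0.
rewrite -expR_sum mulr_suml -sumrN; congr expR.
by apply: eq_bigr => i _; rewrite mxE.
Qed.

Lemma measurable_gauss_comp (R : realType) n (c : R) :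
  measurable_fun setT (@gauss_comp R n c).
Proof.
rewrite (_ : gauss_comp c = fun x : 'rV[R]_n =>
    \prod_(i < n) expR (- ((c * x ord0 i) ^+ 2 / 2))); last first.
  by apply/funext => x; exact: gauss_compE.
apply: measurable_prod => i _; apply: measurableT_comp => //.
apply: measurableT_comp => //; apply: measurable_funM => //.
apply: measurable_funX; apply: measurable_funM => //.
exact: measurable_coord_rV.
Qed.

(** Each coordinate contributes the integral of an unnormalized normal density of
   standard deviation 1 / c. *)
Lemma mu_gauss_comp (R : realType) n (c : R) : 0 < c ->
  mu (@gauss_comp R n c) = ((Num.sqrt (pi *+ 2) / c) ^+ n)%:E.
Proof.
move=> c0; pose g (t : R) := expR (- ((c * t) ^+ 2 / 2)).
rewrite /mu; under eq_integral do rewrite gauss_compE.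
have c0' : c != 0 by rewrite gt_eqF.
have gE : g = normal_fun 0 c^-1.
  apply/funext => t; rewrite /g /normal_fun subr0; congr expR.
  by field.
apply: (@integral_prod_coord R n g) => [||].
- by rewrite gE; exact: measurable_normal_fun.
- by move=> t; exact: expR_ge0.
- pose a : R := normal_peak c^-1.
  have a0 : 0 < a by apply: normal_peak_gt0; rewrite invr_eq0.
  have aE : a = (Num.sqrt (pi *+ 2) / c)^-1.
    rewrite /a /normal_peak -mulrnAr sqrtrM ?sqr_ge0// sqrtr_sqr.
    by rewrite gtr0_norm ?invr_gt0// mulrC.
  have := integral_normal_pdf 0 c^-1.
  rewrite normal_pdfE ?invr_eq0//.
  under eq_integral do rewrite EFinM.
  rewrite ge0_integralZl_EFin//=; last 3 first.
  - by move=> t _; rewrite lee_fin; exact: normal_fun_ge0.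
  - by apply/measurable_EFinP; exact: measurable_normal_fun.
  - exact: ltW.
  rewrite -/a -gE => h.
  have -> : Num.sqrt (pi *+ 2) / c = a^-1 by rewrite aE invrK.
  by rewrite -[RHS]mule1 -h muleA -EFinM mulVf ?gt_eqF// mul1e.
Qed.

Lemma gaussE (R : realType) n : @gauss R n = gauss_comp 1.
Proof. by apply/funext => x; rewrite /gauss_comp scale1r. Qed.

Lemma gauss_comp_gt0 (R : realType) n (c : R) (x : 'rV[R]_n) : 0 < gauss_comp c x.
Proof. exact: expR_gt0. Qed.

Lemma lebesgue_rVT (R : realType) n : (0 < n)%N ->
  lebesgue_rV R n [set: 'rV[R]_n] = +oo%E.
Proof.
move=> n0; have := @lebesgue_rV_box R n (fun=> setT) (fun=> measurableT).
rewrite (_ : [set v | _] = setT); last by apply/seteqP; split.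
move=> ->; rewrite (_ : lebesgue_measure [set: R] = +oo%E); last first.
  by have := @lebesgue_measure_itv R `]-oo, +oo[; rewrite set_itvNyy.
case: n n0 => // n _; elim: n => [|n IH]; first by rewrite big_ord1.
by rewrite big_ord_recl IH mulyy.
Qed.

Lemma mu_gauss_comp0 (R : realType) n : (0 < n)%N ->
  mu (@gauss_comp R n 0) = +oo%E.
Proof.
move=> n0; rewrite /mu (_ : (fun _ => _) = cst 1%E); last first.
  apply/funext => x; rewrite /= gauss_compE big1// => i _.
  by rewrite mul0r expr0n mul0r oppr0 expR0.
by rewrite integral_cst// mul1e; exact: lebesgue_rVT.
Qed.

(** * Supporting lines of decreasing convex functions *)

(** Take for k the infimum of the opposite slopes of the chords that end at t0
   from the left. It is nonnegative since phi decreases, and by the three-chord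
   inequality it dominates the opposite slopes of the chords starting at t0. *)
Lemma supporting_line (R : realType) (phi : R -> R) (t0 : R) :
  class_Phi phi -> 0 < t0 ->
  exists2 k : R, 0 <= k & forall t, 0 < t -> phi t0 + k * (t0 - t) <= phi t.
Proof.
move=> [_ phi_decr phi_conv] t00.
pose slope s := (phi s - phi t0) / (t0 - s).
pose S := [set slope s | s in [set s | 0 < s < t0]].
have S0 : S !=set0.
  by exists (slope (t0 / 2)), (t0 / 2) => //=; apply/andP; split; lra.
have Slb : lbound S 0.
  move=> _ [s /andP[s0 st] <-]; apply: divr_ge0; rewrite subr_ge0.
    by apply: phi_decr => //; exact: ltW.
  exact: ltW.
exists (inf S); first exact: lb_le_inf.
move=> t t_gt0; have [tt0|tt0|->] := ltgtP t t0; last by rewrite subrr mulr0 addr0.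
- have : inf S <= slope t.
    apply: ge_inf; first by exists 0.
    by exists t => //=; rewrite t_gt0.
  by rewrite /slope ler_pdivlMr ?subr_gt0//; lra.
- suff : (phi t0 - phi t) / (t - t0) <= inf S.
    by rewrite ler_pdivrMr ?subr_gt0//; lra.
  apply: lb_le_inf => // _ [s /andP[s0 st] <-].
  rewrite ler_pdivrMr ?subr_gt0// /slope mulrAC ler_pdivlMr ?subr_gt0//.
  have st' : s < t by lra.
  (* the weight for which t0 = l * s + (1 - l) * t *)
  pose l := (t - t0) / (t - s).
  have ts : 0 < t - s by rewrite subr_gt0.
  have l0 : 0 < l by apply: divr_gt0; rewrite subr_gt0.
  have l1 : l < 1 by rewrite ltr_pdivrMr//; lra.
  have := phi_conv s t l s0 t_gt0 (negbT (lt_eqF st')) l0 l1.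
  have -> : l * s + (1 - l) * t = t0 by rewrite /l; field; rewrite gt_eqF.
  have -> : l * phi s + (1 - l) * phi t =
      ((t - t0) * phi s + (t0 - s) * phi t) / (t - s).
    by rewrite /l; field; rewrite gt_eqF.
  by rewrite ltr_pdivlMr//; lra.
Qed.

(** The supporting line also lies below the value at 0, since phi_ext phi 0 is the
   supremum of phi and the line is continuous. *)
Lemma supporting_line_ext (R : realType) (phi : R -> R) (t0 : R) :
  class_Phi phi -> 0 < t0 ->
  exists2 k : R, 0 <= k &
    forall t, 0 <= t -> ((phi t0 + k * (t0 - t))%:E <= phi_ext phi t)%E.
Proof.
move=> hphi t00; have [k k0 hk] := supporting_line hphi t00; exists k => // t.
rewrite le_eqVlt => /predU1P[<-|t_gt0]; last first.
  by rewrite /phi_ext gt_eqF// lee_fin hk.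
have [_ phi_decr _] := hphi.
rewrite /phi_ext eqxx.
have cvg_phi : (phi s)%:E @[s --> 0^'+] --> ereal_sup
    [set (phi s)%:E | s in [set` Interval (BRight 0) (BInfty R false)]].
  apply: nonincreasing_at_right_cvge => // s u.
  rewrite !in_itv/= !andbT => s0 _ su.
  by rewrite lee_fin; exact: phi_decr.
rewrite (cvg_lim _ cvg_phi)//.
apply/lee_addgt0Pr => e e0.
(* between 0 and s the line loses k * s, which is at most e *)
pose s := e / (k + 1).
have k1 : 0 < k + 1 by lra.
have s0 : 0 < s by exact: divr_gt0.
apply: (@le_trans _ _ ((phi s)%:E + e%:E)%E).
  rewrite lee_fin; have := hk s s0.
  have : k * s <= e.
    by rewrite /s mulrCA ler_piMr ?ltW// ltr_pdivrMr//; lra.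
  rewrite subr0 mulrBr; lra.
rewrite leeD2r//; apply: ereal_sup_ubound; exists s => //=.
by rewrite in_itv/= s0.
Qed.

(** * Mass and polarity in the class D *)

Section orlicz.
Context (R : realType) (n : nat).
Implicit Types (p q w : 'rV[R]_n -> R) (phi : R -> R).

Lemma mu_ge0 p : (forall x, 0 <= p x) -> (0 <= mu p)%E.
Proof. by move=> p0; apply: integral_ge0 => x _; rewrite lee_fin. Qed.

Lemma mu_gauss_gt0 : exists2 N : R, 0 < N & mu (@gauss R n) = N%:E.
Proof.
exists ((Num.sqrt (pi *+ 2) / 1) ^+ n); last by rewrite gaussE mu_gauss_comp.
by rewrite exprn_gt0// divr1 sqrtr_gt0 mulrn_wgt0// pi_gt0.
Qed.

Lemma polar_ge0 q : (forall x, 0 < q x) -> forall y, 0 <= polar q y.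
Proof.
move=> q0 y; apply: lb_le_inf.
  by exists (expR (- dotp 0 y) / q 0), 0.
by move=> _ [x _ <-]; rewrite divr_ge0 ?expR_ge0// ltW.
Qed.

Lemma mu_polar_ge0 q : (forall x, 0 < q x) -> 0 <= fine (mu (polar q)).
Proof. by move=> q0; apply/fine_ge0/mu_ge0/polar_ge0. Qed.

(** The defining inequality of D, divided by N = mu gauss; when mu (polar q) is
   infinite the left-hand side is 0 by the default value of fine. *)
Lemma classD_normalized q : classD q ->
  ((fine (mu (polar q)) / fine (mu (@gauss R n)))%:E * mu q <= mu (@gauss R n))%E.
Proof.
move=> [[_ q0]]; have [N N0 ->] /= := mu_gauss_gt0.
have := mu_ge0 (polar_ge0 q0); case: (mu (polar q)) => [r r0 h| _ _|//].
  rewrite /= mulrC EFinM -muleA [(r%:E * _)%E]muleC.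
  by rewrite lee_pdivrMl// -EFinM -expr2 EFin_expe.
by rewrite /= mul0r mul0e lee_fin ltW.
Qed.

(** * Bounds on the divergence *)

(** Jensen's inequality for the divergence: apply the supporting line at t0 to
   the ratio a q / w, multiply by w and integrate. The term with a minus sign is
   moved to the right, so that mu w and mu q may be infinite. The slope k depends
   on phi and t0 alone. *)
Lemma jensen_orlicz_div phi t0 : class_Phi phi -> 0 < t0 ->
  exists2 k : R, 0 <= k & forall a q w, 0 <= a -> Fplus q -> Fplus w ->
    ((phi t0 + k * t0)%:E * mu w <= orlicz_div phi a q w + (k * a)%:E * mu q)%E.
Proof.
move=> hphi t00; have [k k0 hk] := supporting_line_ext hphi t00.
have [phi_gt0 _ _] := hphi.
exists k => // a q w a0 [mq q0] [mw w0].
have b0 : 0 < phi t0 + k * t0 by rewrite ltr_wpDr ?phi_gt0// mulr_ge0// ltW.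
have phi_ext_ge0 t : 0 <= t -> (0 <= phi_ext phi t)%E.
  rewrite le_eqVlt => /predU1P[<-|t_gt0].
    by apply: le_trans (hk 0 (lexx _)); rewrite lee_fin subr0 ltW.
  by rewrite /phi_ext gt_eqF// lee_fin ltW// phi_gt0.
(* the positive part of the supporting line at the ratio a q / w, times w: a
   measurable minorant of the integrand, to which additivity applies *)
pose h x := Num.max 0 ((phi t0 + k * t0) * w x - k * a * q x).
have h0 x : 0 <= h x by rewrite le_max lexx.
have mh : measurable_fun setT h.
  apply: measurable_maxr => //.
  by apply: measurable_funB; exact: measurable_funM.
have h_le : (\int[lebesgue_rV R n]_x (h x)%:E <= orlicz_div phi a q w)%E.
  apply: le_ge0_integral => x; first by rewrite lee_fin.
  have t_ge0 : 0 <= a * q x / w x by rewrite divr_ge0 ?mulr_ge0// ltW.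
  have wx0 := ltW (w0 x).
  rewrite /h EFin_max ge_max mule_ge0 ?phi_ext_ge0 ?lee_fin//=.
  apply: (@le_trans _ _ ((phi t0 + k * (t0 - a * q x / w x))%:E * (w x)%:E)%E).
    rewrite -EFinM lee_fin le_eqVlt; apply/orP; left; apply/eqP.
    by field; rewrite gt_eqF.
  by rewrite lee_pmul2r// ?lte_fin//; exact: hk.
have mq' : measurable_fun setT (EFin \o q) by exact/measurable_EFinP.
have mw' : measurable_fun setT (EFin \o w) by exact/measurable_EFinP.
rewrite /mu -!ge0_integralZl_EFin//; last 4 first.
- by move=> x _; rewrite lee_fin ltW.
- exact: mulr_ge0.
- by move=> x _; rewrite lee_fin ltW.
- exact: ltW.
apply: le_trans (leeD2r _ h_le).
rewrite -ge0_integralD//; last 4 first.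
- by move=> x _; rewrite lee_fin.
- exact/measurable_EFinP.
- by move=> x _; rewrite -EFinM lee_fin !mulr_ge0// ltW.
- by under eq_fun do rewrite -EFinM; apply/measurable_EFinP; exact: measurable_funM.
apply: le_ge0_integral => x.
  by rewrite -EFinM lee_fin mulr_ge0// ltW.
rewrite -!EFinM -EFinD lee_fin -lerBlDr.
by rewrite le_max lexx orbT.
Qed.

Lemma density_mass (Q : {finite_measure set 'rV[R]_n -> \bar R}) q :
  has_density Q q -> (mu q < +oo)%E.
Proof.
move=> [_ QE]; have <- : Q setT = mu q := QE setT measurableT.
by rewrite ltey_eq fin_num_measure.
Qed.

(** Jensen's inequality at t0 = c ^ n = mu gauss / mu (gauss_comp c), the largest
   value that the mean ratio a mu(q) / mu (gauss_comp c) can take for q in D, as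
   a mu(q) is at most mu gauss; the two linear terms k * mu gauss then cancel. *)
Lemma geominimal_gauss_comp_ge phi c : class_Phi phi -> 0 < c ->
  ((phi (c ^+ n))%:E * mu (@gauss_comp R n c)
    <= dual_orlicz_geominimal phi (@gauss_comp R n c))%E.
Proof.
move=> hphi c0; have t00 : 0 < c ^+ n by rewrite exprn_gt0.
have [k k0 hk] := jensen_orlicz_div hphi t00.
apply: le_ereal_inf_tmp => _ [q [[Dq _] _] <-].
have [Fq _] := Dq; have [_ q0] := Fq.
have Fg : Fplus (@gauss_comp R n c).
  by split=> [|x]; [exact: measurable_gauss_comp|exact: gauss_comp_gt0].
have [N N0 muN] := mu_gauss_gt0.
have muc : mu (@gauss_comp R n c) = (N / c ^+ n)%:E.
  move: muN; rewrite mu_gauss_comp// gaussE mu_gauss_comp// => -[<-].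
  by rewrite divr1 expr_div_n.
have Dq_mass := classD_normalized Dq.
set a := (fine (mu (polar q)) / _) in Dq_mass *.
have a0 : 0 <= a by rewrite divr_ge0 ?mu_polar_ge0// muN ltW.
rewrite muN in Dq_mass.
have := hk a q _ a0 Fq Fg; rewrite muc => hq.
have kN : ((k * a)%:E * mu q <= (k * N)%:E)%E.
  by rewrite !EFinM -muleA lee_wpmul2l.
have := le_trans hq (leeD2l _ kN).
have -> : ((phi (c ^+ n) + k * c ^+ n)%:E * (N / c ^+ n)%:E =
    (phi (c ^+ n))%:E * (N / c ^+ n)%:E + (k * N)%:E)%E.
  by rewrite -!EFinM -EFinD; congr EFin; field; rewrite gt_eqF.
by rewrite leeD2rE.
Qed.

(** In Jensen's inequality, an infinite mass on the left and a finite mu q on the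
   right leave the divergence as the only infinite term; t0 = 1 stands
   for any positive number. *)
Lemma geominimal_infinite phi w : class_Phi phi -> Fplus w ->
  mu w = +oo%E -> dual_orlicz_geominimal phi w = +oo%E.
Proof.
move=> hphi Fw wy; have [k k0 hk] := jensen_orlicz_div hphi ltr01.
have [phi_gt0 _ _] := hphi.
apply/eqP; rewrite -leye_eq.
apply: le_ereal_inf_tmp => _ [q [[[Fq _] _] [Q Qq]] <-].
have [_ q0] := Fq; have [N N0 muN] := mu_gauss_gt0.
set a := fine (mu (polar q)) / _.
have a0 : 0 <= a by rewrite divr_ge0 ?mu_polar_ge0// muN ltW.
have := hk a q w a0 Fq Fw.
rewrite wy gt0_muley; last by rewrite lte_fin ltr_pwDl ?phi_gt0// mulr1.
have : ((k * a)%:E * mu q < +oo)%E.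
  apply: lte_mul_pinfty => //; first by rewrite lee_fin mulr_ge0.
  exact: density_mass Qq.
case: (orlicz_div phi a q w) => [r| |] //; rewrite leye_eq.
by case: (_ * _)%E.
Qed.

Lemma orlicz_div_self phi a p : class_Phi phi -> 0 < a -> Fplus p ->
  orlicz_div phi a p p = ((phi a)%:E * mu p)%E.
Proof.
move=> [phi_gt0 _ _] a0 [mp p0]; rewrite /orlicz_div.
rewrite /mu -ge0_integralZl_EFin//; last 3 first.
- by move=> x _; rewrite lee_fin ltW.
- exact/measurable_EFinP.
- by rewrite ltW// phi_gt0.
apply: eq_integral => x _.
by rewrite mulfK ?gt_eqF// /phi_ext gt_eqF.
Qed.

End orlicz.

Theorem theorem16 (R : realType) (n : nat) (hn : (0 < n)%N)
    (phi : R -> R) (hphi : class_Phi phi)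
    (P : {finite_measure set 'rV[R]_n -> \bar R}) (p : 'rV[R]_n -> R)
    (hP : has_density P p) (hD : classD p) (hlc : log_concave p)
    (c1 : R) (hc1 : c1 = (fine (mu (polar p)) / fine (mu (@gauss R n))) `^ (n%:R^-1)) :
  (dual_orlicz_affine phi p <= dual_orlicz_geominimal phi p)%E /\
  (dual_orlicz_geominimal phi p <= dual_orlicz_geominimal phi (@gauss_comp R n c1))%E.
Proof.
split.
  apply: ereal_inf_le_tmp => _ [q [[Dq _] Qq] <-]; by exists q.
have [N N0 muN] := mu_gauss_gt0 R n.
have [Fp _] := hD; have [_ p0] := Fp.
have Dp_mass := classD_normalized hD.
have : 0 <= fine (mu (polar p)) / fine (mu (@gauss R n)).
  by rewrite divr_ge0 ?mu_polar_ge0// muN ltW.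
move: hc1 Dp_mass; set a := fine (mu (polar p)) / _ => hc1 Dp_mass.
rewrite le_eqVlt => /predU1P[a0|a0].
  (* here c1 = 0, and the right-hand side is infinite *)
  rewrite [leRHS]geominimal_infinite ?leey//.
    by split=> [|x]; [exact: measurable_gauss_comp|exact: gauss_comp_gt0].
  by rewrite hc1 -a0 powR0 ?mu_gauss_comp0// invr_neq0// pnatr_eq0 -lt0n.
have c10 : 0 < c1 by rewrite hc1 powR_gt0.
have c1n : c1 ^+ n = a.
  rewrite -powR_mulrn ?ltW// hc1 -powRrM mulVf ?pnatr_eq0 -?lt0n//.
  by rewrite powRr1 ?ltW.
apply: le_trans (geominimal_gauss_comp_ge n hphi c10).
apply: (@le_trans _ _ (orlicz_div phi a p p)).
  by apply: ereal_inf_lbound; exists p => //; split=> //; exists P.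
rewrite orlicz_div_self// c1n; apply: lee_wpmul2l.
  by have [phi_gt0 _ _] := hphi; rewrite lee_fin ltW// phi_gt0.
have -> : mu (@gauss_comp R n c1) = (a^-1%:E * mu (@gauss R n))%E.
  rewrite gaussE !mu_gauss_comp// -EFinM divr1 expr_div_n c1n.
  by rewrite mulrC.
by rewrite lee_pdivlMl.
Qed.
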